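(* Consider $N$ single-integrator agents $\dot q_i=u_i$, $q_i\in\mathbb{R}^n$, $i=1,\dots,N$, whose actuators saturate: $$u_i=\mathrm{Sat}_i(\hat u_i),\qquad \hat u_i=-\sum_{j\in\mathcal{N}_i(0)}\nabla_i\psi(\|q_{ij}\|),$$ where $\psi$ and $\Psi$ are a generalized potential with value $\Psi_{max}$ as in the context. Suppose that the initial communication graph is undirected and connected, that there is $\epsilon>0$ with $\|q_{ij}(0)\|\le r-\epsilon$ for all $(i,j)\in\mathcal{E}(0)$, and that $\Psi(q(0))<\Psi_{max}$. Then, along every solution of the closed loop, connectivity-preserving consensus is achieved for any saturation bounds: $\|q_i(t)-q_j(t)\|<r$ for all $t\ge0$ and all $(i,j)\in\mathcal{E}(0)$, and $q_i(t)-q_j(t)\to0$ as $t\to\infty$ for all $i,j\in\{1,\dots,N\}$.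
   Context: All agents have communication radius $r>0$; $\mathcal{E}(0)$ is the initial edge set and $\mathcal{N}_i(0)=\{j:(i,j)\in\mathcal{E}(0)\}$. Put $q_{ij}=q_j-q_i$, and let $\nabla_i$ denote the gradient with respect to $q_i$. Saturation: $\mathrm{Sat}_i(\hat u_i)=(\mathrm{sat}_{i1}(\hat u_{i1}),\dots,\mathrm{sat}_{in}(\hat u_{in}))^{\mathsf T}$, where each $\mathrm{sat}_{ik}$ is a standard saturation with bounds $\underline u_{ik}<0<\overline u_{ik}$: $\mathrm{sat}_{ik}(x)=x$ if $\underline u_{ik}\le x\le\overline u_{ik}$, $\overline u_{ik}$ if $x>\overline u_{ik}$, and $\underline u_{ik}$ if $x<\underline u_{ik}$. Generalized potential: $\Psi(q)=\frac12\sum_{i=1}^N\sum_{j\in\mathcal{N}_i(0)}\psi(\|q_{ij}\|)$, where $\psi:[0,r]\to[0,+\infty]$ is continuous, finite on $[0,r)$, and 1. $\psi(s)=0\Leftrightarrow s=0$; 2. as a function of $s^2$, $\psi$ is continuously differentiable on $[0,r)$ with positive derivative $\partial\psi/\partial(s^2)>0$ (so $\nabla_i\psi(\|q_{ij}\|)=2\frac{\partial\psi(\|q_{ij}\|)}{\partial\|q_{ij}\|^2}(q_i-q_j)$); 3. there is $\Psi_{max}\in(0,+\infty]$, not necessarily finite, with $\Psi(q)\ge\Psi_{max}$ whenever $\|q_{ij}\|\le r$ for all $(i,j)\in\mathcal{E}(0)$ and $\|q_{ij}\|=r$ for some $(i,j)\in\mathcal{E}(0)$. Example: $\psi(s)=s^2/(r^2-s^2)$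 with $\Psi_{max}=\infty$, or $\psi(s)=s^2/(r^2-s^2+Q)$, $Q>0$, with $\Psi_{max}=r^2/Q$. *)

(* Defs.v *)
From mathcomp Require Import all_boot all_order all_algebra.
From mathcomp Require Import all_classical all_reals all_analysis.
Import Order.TTheory GRing.Theory Num.Theory.
Import numFieldNormedType.Exports.

Set Implicit Arguments.
Unset Strict Implicit.
Unset Printing Implicit Defensive.

Local Open Scope classical_set_scope.
Local Open Scope ring_scope.

(* The canonical norm `|x| on 'rV[R]_n is the sup norm, hence this definition;
   both norms induce the same topology. *)
Definition enorm (R : realType) (n : nat) (x : 'rV[R]_n) : R :=
  Num.sqrt (\sum_(k < n) x 0 k ^+ 2).

Definition grad (R : realType) (n : nat) (f : 'rV[R]_n -> R) (x : 'rV[R]_n) :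
    'rV[R]_n :=
  \row_k 'D_(delta_mx 0 k) f x.

(* l is the derivative of f at x relative to A; at an endpoint of an interval
   this is the one-sided derivative. *)
Definition is_derive_within (R : realType) (A : set R) (f : R -> R) (x l : R) :
    Prop :=
  (f y - f x) / (y - x) @[y --> within A x^'] --> l.

Section potential.
Variables (R : realType) (N n : nat) (e : rel 'I_N) (r : R).
Implicit Types (psi : R -> \bar R) (q : 'I_N -> 'rV[R]_n).

(* Only the values of psi on [0, r] are ever constrained or used. *)

Definition total_potential psi q : \bar R :=
  ((2^-1)%:E *
   \sum_(i < N) \sum_(j < N | e i j) psi (enorm (q j - q i)))%E.

(* psi as a function of the squared distance; meaningful on [0, r^2[, where
   the underlying value of psi is finite. *)
Definition of_square psi (sigma : R) : R := fine (psi (Num.sqrt sigma)).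

Record generalized_potential psi (Psimax : \bar R) : Prop := {
  potential_ge0 : forall s : R, 0 <= s <= r -> (0 <= psi s)%E ;
  potential_continuous : {within `[0, r], continuous psi} ;
  potential_fin : forall s : R, 0 <= s < r -> psi s \is a fin_num ;
  potential_eq0 : forall s : R, 0 <= s <= r -> (psi s = 0%E <-> s = 0) ;
  potential_C1 : exists dpsi : R -> R,
    {within `[0, r ^+ 2[, continuous dpsi} /\
    forall sigma : R, 0 <= sigma < r ^+ 2 ->
      0 < dpsi sigma /\
      is_derive_within `[0, r ^+ 2[ (of_square psi) sigma (dpsi sigma) ;
  potential_max_gt0 : (0 < Psimax)%E ;
  potential_max : forall q,
    (forall i j, e i j -> enorm (q j - q i) <= r) ->
    (exists i j, e i j /\ enorm (q j - q i) = r) ->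
    (Psimax <= total_potential psi q)%E
}.

Definition nominal_control psi q (i : 'I_N) : 'rV[R]_n :=
  - \sum_(j < N | e i j)
      grad (fun x : 'rV[R]_n => fine (psi (enorm (q j - x)))) (q i).

Definition sat (lo hi x : R) : R :=
  if x < lo then lo else if hi < x then hi else x.

Definition Sat (lo hi : 'I_n -> R) (v : 'rV[R]_n) : 'rV[R]_n :=
  \row_k sat (lo k) (hi k) (v 0 k).

(* The right-hand side of the closed loop is defined only where all initial
   edges are shorter than r, so the differential equation is imposed exactly at
   the times when this is the case.  That the trajectory remains in this region
   is thereby not part of being a solution: a trajectory that leaves it at some
   time and is continued arbitrarily (but continuously) is still a solution.
   At t = 0 continuity suffices, since the right derivative at 0 then follows
   from the equation at t > 0. *)
Definition closed_loop_solution psi (lo hi : 'I_N -> 'I_n -> R)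
    (q : R -> 'I_N -> 'rV[R]_n) : Prop :=
  (forall i, {within `[0, +oo[, continuous (fun t => q t i)}) /\
  (forall t : R, 0 < t ->
     (forall i j, e i j -> enorm (q t j - q t i) < r) ->
     forall i, is_derive t 1 (fun s => q s i)
                 (Sat (lo i) (hi i) (nominal_control psi (q t) i))).

End potential.

(* Main.v *)
Require Import Defs.
From mathcomp Require Import all_boot all_order all_algebra.
From mathcomp Require Import all_classical all_reals all_analysis.
From mathcomp Require Import ring lra.
Import Order.TTheory GRing.Theory Num.Theory.
Import numFieldNormedType.Exports.

Local Open Scope classical_set_scope.
Local Open Scope ring_scope.

Set Implicit Arguments.
Unset Strict Implicit.
Unset Printing Implicit Defensive.

(** The energy [Psi] is a Lyapunov function.  Where all edges are shorter than
    [r], the nominal control [u_i] is minus the gradient of [Psi] in [q_i], so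
    along a solution the derivative of [Psi] is minus the sum of the products
    [u_ik * sat (u_ik)] ([is_derive_energy]), each of which is nonnegative
    because the saturation bounds have opposite signs.

    _Connectivity._  A configuration with edges shorter than [r] and energy at
    most [Psi (q 0) < Psimax] has all its edges at length at most some
    [rho < r] that does not depend on the configuration ([edge_margin]).  If
    [psi r] is infinite, a longer edge alone would cost more than the available
    energy.  If [psi r] is finite, dilating a configuration whose longest edge
    is almost [r] until that edge has length [r] changes the energy very little,
    by uniform continuity of [psi] on [[0, r]], although it has to raise it to at
    least [Psimax].  The energy does not increase before the first time at which an
    edge reaches [r], so the edges keep the margin up to that time, and by
    continuity there is no such time ([edges_stay_short]).

    _Consensus._  With the edges confined to [[0, rho]], the derivative of [psi]
    with respect to the squared length lies between two positive constants
    ([square_profile_bounds]).  Summation by parts over the graph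
    ([laplacian_form]) and the bound on the diameter of the configuration given
    by connectedness ([connected_oscillation]) then show that, as long as the
    energy is at least [L > 0], it is dissipated at a rate bounded below by a
    positive constant ([dissipation_ge]).  Hence the energy, being nonnegative and
    nonincreasing, tends to zero; it dominates the sum of the squared edge
    lengths up to a constant factor, and
    connectedness spreads the conclusion from the edges to all pairs. *)

(** * The potential as a function of the squared length *)

Lemma is_derive_cvg (R : realType) (f : R -> R) (x l : R) :
  h^-1 * (f (h + x) - f x) @[h --> 0^'] --> l -> is_derive x 1 f l.
Proof.
move=> fl.
have fl' : h^-1 *: ((f \o shift x) (h *: (1 : R)) - f x) @[h --> 0^'] --> l.
  by under eq_fun do rewrite /= /GRing.scale /= mulr1.
by split; [exact: cvgP fl' | exact/cvg_lim].
Qed.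

(** Continuing [g] linearly to the left of [0] with slope [l0] turns its
    derivative relative to [[0, b[] into a two-sided derivative. *)
Lemma is_derive_linear_extension (R : realType) (g : R -> R) (b x l l0 : R) :
  g 0 = 0 -> 0 <= x < b -> is_derive_within `[0, b[ g x l ->
  (x = 0 -> l = l0) ->
  is_derive x 1 (fun s => if s < 0 then l0 * s else g s) l.
Proof.
move=> g0 /andP[x0 xb] gl ll0; apply: is_derive_cvg.
apply/cvgrPdist_lt => e e0.
move/cvgrPdist_lt : gl => /(_ e e0); rewrite near_withinE.
case=> d /= d0 gd.
have ? : x < 0 = false by lra.
have x00 : x = 0 \/ 0 < x.
  by case: (eqVneq x 0) => [|xn0]; [left | right; rewrite lt0r xn0].
have hx : \forall h \near (0 : R)^', x = 0 \/ `|h| < x.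
  case: x00 => [x00|xgt0]; first by apply: nearW; left.
  by apply: filterS (dnbhs0_lt xgt0) => h; right.
near=> h.
have h0 : h != 0 by near: h; exact: nbhs_dnbhs_neq.
have hd : `|h| < d by near: h; apply: dnbhs0_lt.
have hb : `|h| < b - x by near: h; apply: dnbhs0_lt; lra.
have hx1 : x = 0 \/ `|h| < x by near: h.
rewrite [X in _ - _ * (_ - X)]ifF //.
case: (ltP (h + x) 0) => hx0.
  have x_0 : x = 0 by case: hx1 => //; rewrite ltr_norml => /andP[h1 h2]; lra.
  rewrite ll0 // x_0 g0 addr0 subr0 mulrC mulfK // subrr normr0 //.
have -> : h^-1 * (g (h + x) - g x) = (g (h + x) - g x) / (h + x - x).
  by rewrite addrK mulrC.
apply: gd => /=.
- by rewrite opprD addrA addrAC subrr sub0r normrN.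
- by rewrite -subr_eq0 addrK.
- rewrite in_itv /= hx0 /=; move: hb; rewrite ltr_norml => /andP[h1 h2]; lra.
Unshelve. all: by end_near. Qed.

(** The properties of the potential that the proof uses, read on the squared
    length: [F] gives the finite part of [psi] at lengths [s >= 0] through
    [s ^+ 2], and [f] is the derivative of [F].  It is two-sided even at [0]:
    the values of [F] at negative arguments, which represent no length, are
    chosen for this purpose. *)
Definition square_profile (R : realType) (r : R) (psi : R -> \bar R)
    (F f : R -> R) : Prop :=
  [/\ F 0 = 0,
      forall s, 0 <= s -> fine (psi s) = F (s ^+ 2),
      forall x, 0 <= x < r ^+ 2 -> 0 < f x,
      forall x, 0 <= x < r ^+ 2 -> is_derive x 1 F (f x) &
      {within `[0, r ^+ 2[, continuous f}].

Lemma square_profile_exists (R : realType) (N n : nat) (e : rel 'I_N) (r : R)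
    (psi : R -> \bar R) (Psimax : \bar R) :
  0 < r -> generalized_potential n e r psi Psimax ->
  exists F f, square_profile r psi F f.
Proof.
move=> r0 [_ _ _ psi0 [f [fc fd]] _ _].
have psi00 : psi 0 = 0%E by apply/(psi0 0); lra.
have sq0 : of_square psi 0 = 0 by rewrite /of_square sqrtr0 psi00.
exists (fun s => if s < 0 then f 0 * s else of_square psi s), f; split=> //.
- by rewrite ltxx.
- move=> s s0; have -> : s ^+ 2 < 0 = false by have := sqr_ge0 s; lra.
  by rewrite /of_square sqrtr_sqr ger0_norm.
- by move=> x /fd[].
- move=> x xr; apply: (is_derive_linear_extension sq0 xr (fd x xr).2).
  by move=> ->.
Qed.

(** On a compact range of squared lengths the derivative is bounded away from
    [0] and infinity, and by the mean value theorem so is the ratio [F x / x].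
    *)
Lemma square_profile_bounds (R : realType) (r rho : R) (psi : R -> \bar R)
    (F f : R -> R) :
  square_profile r psi F f -> 0 <= rho < r ->
  exists c C, [/\ 0 < c, 0 < C &
    forall x, 0 <= x <= rho ^+ 2 ->
      [/\ c <= f x, f x <= C, c * x <= F x & F x <= C * x]].
Proof.
move=> [F0 _ fpos Fd fc] /andP[rho0 rhor].
have rho2 : 0 <= rho ^+ 2 by exact: sqr_ge0.
have rhor2 : rho ^+ 2 < r ^+ 2 by nra.
have fc' : {within `[0, rho ^+ 2], continuous f}.
  apply: continuous_subspaceW fc => x /=; rewrite !in_itv /=; lra.
have [a] := EVT_min rho2 fc'; rewrite in_itv /= => a0 amin.
have [b] := EVT_max rho2 fc'; rewrite in_itv /= => b0 bmax.
have fb : forall x, 0 <= x <= rho ^+ 2 -> f a <= f x <= f b.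
  by move=> x x0; rewrite amin ?bmax // in_itv.
exists (f a), (f b); split; [apply: fpos; lra | apply: fpos; lra |].
move=> x /andP[x0 xr].
have [y yx Fx] : exists2 y, y \in `[0, x] & F x - F 0 = f y * (x - 0).
  apply: MVT_segment => // [y|]; rewrite ?in_itv /=; first by move=> ?; apply: Fd; lra.
  apply: derivable_within_continuous => y; rewrite in_itv /= => y0.
  by have [] : is_derive y 1 F (f y) by apply: Fd; lra.
move: Fx; rewrite F0 !subr0 => ->.
move: yx; rewrite in_itv /= => yx.
have := fb x ltac:(lra); have := fb y ltac:(lra).
move=> /andP[? ?] /andP[? ?]; split=> //; exact: ler_wpM2r.
Qed.

(** * The interaction energy and the nominal feedback *)

Lemma is_derive_bigsum (R : realType) (I : finType) (P : pred I)
    (h : I -> R -> R) (dh : I -> R) (x : R) :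
  (forall i, P i -> is_derive x 1 (h i) (dh i)) ->
  is_derive x 1 (fun s => \sum_(i | P i) h i s) (\sum_(i | P i) dh i).
Proof.
move=> hd.
have -> : (fun s => \sum_(i | P i) h i s) = \sum_(i | P i) h i.
  by apply/funext => s; rewrite fct_sumE.
apply: (big_ind2 (fun (a : R -> R) b => is_derive x 1 a b)) => //.
- exact: is_derive_cst.
- by move=> ? ? ? ? ? ?; exact: is_deriveD.
Qed.

(** The squared Euclidean norm. *)
Definition sqn (R : realType) (n : nat) (x : 'rV[R]_n) : R :=
  \sum_(k < n) x 0 k ^+ 2.

Section sqn_theory.
Context {R : realType} {n : nat}.
Implicit Types x y : 'rV[R]_n.

Lemma sqn_ge0 x : 0 <= sqn x.
Proof. by apply: sumr_ge0 => k _; exact: sqr_ge0. Qed.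

Lemma sqnB x y : sqn (x - y) = sqn (y - x).
Proof. by apply: eq_bigr => k _; rewrite !mxE; ring. Qed.

Lemma sqnZ (a : R) x : sqn (a *: x) = a ^+ 2 * sqn x.
Proof. by rewrite mulr_sumr; apply: eq_bigr => k _; rewrite mxE exprMn. Qed.

Lemma sqr_coord_le_sqn x k : x 0 k ^+ 2 <= sqn x.
Proof.
rewrite /sqn (bigD1 k) //= lerDl; apply: sumr_ge0 => i _; exact: sqr_ge0.
Qed.

Lemma enorm_ge0 x : 0 <= enorm x.
Proof. exact: sqrtr_ge0. Qed.

Lemma enormB x y : enorm (x - y) = enorm (y - x).
Proof. by rewrite /enorm -/(sqn _) sqnB. Qed.

Lemma sqr_enorm x : enorm x ^+ 2 = sqn x.
Proof. by rewrite sqr_sqrtr // sqn_ge0. Qed.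

Lemma enormZ (a : R) x : 0 <= a -> enorm (a *: x) = a * enorm x.
Proof.
move=> a0; rewrite /enorm -!/(sqn _) sqnZ sqrtrM ?sqr_ge0 //.
by rewrite sqrtr_sqr ger0_norm.
Qed.

Lemma sqn_le_sqr x (a : R) : 0 <= a -> (sqn x <= a ^+ 2) = (enorm x <= a).
Proof. by move=> a0; rewrite -sqr_enorm ler_sqr ?nnegrE ?enorm_ge0. Qed.

Lemma sqn_lt_sqr x (a : R) : 0 <= a -> (sqn x < a ^+ 2) = (enorm x < a).
Proof. by move=> a0; rewrite -sqr_enorm ltr_sqr ?nnegrE ?enorm_ge0. Qed.

(** The velocity is only required coordinatewise. *)
Lemma is_derive_sqn (c : R -> 'rV[R]_n) (t : R) (v : 'I_n -> R) :
  (forall k, is_derive t 1 (fun s => c s 0 k) (v k)) ->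
  is_derive t 1 (fun s => sqn (c s)) (\sum_k 2 * c t 0 k * v k).
Proof.
move=> cv; apply: is_derive_bigsum => k _.
apply: is_derive_eq (is_deriveX 2 (cv k)) _.
by rewrite /GRing.scale /= expr1.
Qed.

End sqn_theory.

Lemma grad_potential (R : realType) (n : nat) (r : R) (psi : R -> \bar R)
    (F f : R -> R) (z y : 'rV[R]_n) (k : 'I_n) :
  square_profile r psi F f -> sqn (z - y) < r ^+ 2 ->
  grad (fun x : 'rV[R]_n => fine (psi (enorm (z - x)))) y 0 k =
  2 * f (sqn (z - y)) * (y 0 k - z 0 k).
Proof.
move=> [_ psiF _ Fd _] zy; rewrite mxE.
pose c h := z - (h *: delta_mx 0 k + y).
have c0 : c 0 = z - y by rewrite /c scale0r add0r.
have cd : is_derive (0 : R) 1 (fun h => F (sqn (c h)))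
    (2 * f (sqn (z - y)) * (y 0 k - z 0 k)).
  pose d m : R := (m == k)%:R.
  have cv m : is_derive (0 : R) 1 (fun h => c h 0 m) (- d m).
    have -> : (fun h => c h 0 m) = (fun h => (z - y) 0 m + h * - d m).
      by apply/funext => h; rewrite !mxE eqxx /= -/(d m) opprD mulrN addrA addrAC //.
    apply: is_derive_cvg; apply: cvg_near_cst; near=> h.
    have h0 : h != 0 by near: h; exact: nbhs_dnbhs_neq.
    by field.
  have Fc : is_derive (sqn (c 0)) 1 F (f (sqn (c 0))).
    by apply: Fd; rewrite c0 sqn_ge0.
  apply: is_derive_eq (is_derive1_comp Fc (is_derive_sqn cv)) _; rewrite c0 (bigD1 k) //= big1 => [|m /negPf mk].
    by rewrite /d eqxx !mxE /= mulr1n; ring.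
  by rewrite /d mk oppr0 mulr0.
rewrite -(derive_val (is_derive := cd)) /derive.
apply: (f_equal (fun G : R -> R => lim (G @ 0^'))); apply/funext => h /=.
have psiFs x : fine (psi (enorm x)) = F (sqn x).
  by rewrite psiF ?enorm_ge0 // sqr_enorm.
by rewrite !psiFs addr0 c0 /c /GRing.scale /= mulr1.
Unshelve. all: by end_near. Qed.

(** Half the sum of the pair potentials over the ordered edges: the real value
    of the total potential whenever that is finite. *)
Definition energy (R : realType) (N n : nat) (e : rel 'I_N) (F : R -> R)
    (x : 'I_N -> 'rV[R]_n) : R :=
  2^-1 * \sum_(i < N) \sum_(j < N | e i j) F (sqn (x j - x i)).

(** The [k]-th coordinate of the nominal control of agent [i], in closed
    form. *)
Definition feedback (R : realType) (N n : nat) (e : rel 'I_N) (f : R -> R)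
    (x : 'I_N -> 'rV[R]_n) (i : 'I_N) (k : 'I_n) : R :=
  - \sum_(j < N | e i j) 2 * f (sqn (x j - x i)) * (x i 0 k - x j 0 k).

Lemma total_potential_energy (R : realType) (N n : nat) (e : rel 'I_N) (r : R)
    (psi : R -> \bar R) (F f : R -> R) (x : 'I_N -> 'rV[R]_n) :
  square_profile r psi F f ->
  (forall i j, e i j -> psi (enorm (x j - x i)) \is a fin_num) ->
  total_potential e psi x = (energy e F x)%:E.
Proof.
move=> [_ psiF _ _ _] xfin; rewrite /total_potential /energy EFinM.
congr (_ * _)%E; rewrite -sumEFin; apply: eq_bigr => i _.
rewrite -sumEFin; apply: eq_bigr => j eij.
by rewrite -sqr_enorm -psiF ?enorm_ge0 // fineK // xfin.
Qed.

Lemma nominal_control_feedback (R : realType) (N n : nat) (e : rel 'I_N)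
    (r : R) (psi : R -> \bar R) (F f : R -> R) (x : 'I_N -> 'rV[R]_n) i k :
  square_profile r psi F f ->
  (forall i j, e i j -> sqn (x j - x i) < r ^+ 2) ->
  nominal_control e psi x i 0 k = feedback e f x i k.
Proof.
move=> prof xr; rewrite /nominal_control mxE summxE; congr (- _).
by apply: eq_bigr => j eij; rewrite (grad_potential _ prof) ?xr.
Qed.

(** Summation by parts for the weighted graph Laplacian. *)
Lemma laplacian_form (R : realType) (N : nat) (e : rel 'I_N)
    (g : 'I_N -> 'I_N -> R) (a b : 'I_N -> R) :
  symmetric e -> (forall i j, g i j = g j i) ->
  \sum_(i < N) \sum_(j < N | e i j) g i j * ((a j - a i) * (b j - b i)) =
  \sum_(i < N) b i * \sum_(j < N | e i j) 2 * g i j * (a i - a j).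
Proof.
move=> esym gsym.
pose S := \sum_(i < N) \sum_(j < N | e i j) g i j * (a i - a j) * b i.
have -> : \sum_(i < N) b i * \sum_(j < N | e i j) 2 * g i j * (a i - a j) =
    S + S.
  rewrite -big_split /=; apply: eq_bigr => i _; rewrite -big_split mulr_sumr /=.
  by apply: eq_bigr => j _; ring.
have S' : S = \sum_(i < N) \sum_(j < N | e i j) g i j * (a j - a i) * b j.
  rewrite /S (exchange_big_dep xpredT) //=; apply: eq_bigr => i _.
  by apply: eq_big => [j|j _]; [rewrite esym | rewrite gsym].
rewrite {1}S' /S -big_split /=; apply: eq_bigr => i _.
by rewrite -big_split /=; apply: eq_bigr => j _; ring.
Qed.

Lemma is_derive_energy (R : realType) (N n : nat) (e : rel 'I_N) (r : R)
    (psi : R -> \bar R) (F f : R -> R) (q : R -> 'I_N -> 'rV[R]_n) (t : R)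
    (u : 'I_N -> 'I_n -> R) :
  symmetric e -> square_profile r psi F f ->
  (forall i j, e i j -> sqn (q t j - q t i) < r ^+ 2) ->
  (forall i k, is_derive t 1 (fun s => q s i 0 k) (u i k)) ->
  is_derive t 1 (fun s => energy e F (q s))
    (- \sum_i \sum_k feedback e f (q t) i k * u i k).
Proof.
move=> esym [_ _ _ Fd _] qr qd.
pose g i j := f (sqn (q t j - q t i)).
have gsym i j : g i j = g j i by rewrite /g sqnB.
have sd i j : e i j -> is_derive t 1 (fun s => F (sqn (q s j - q s i)))
    (g i j * \sum_k 2 * (q t j - q t i) 0 k * (u j k - u i k)).
  move=> eij; apply: is_derive1_comp.
    by apply: Fd; rewrite sqn_ge0 qr.
  apply: is_derive_sqn => k.
  have -> : (fun s => (q s j - q s i) 0 k) =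
      (fun s => q s j 0 k) - (fun s => q s i 0 k).
    by apply/funext => s; rewrite !mxE.
  exact: is_deriveB.
have Sd := is_derive_bigsum (fun i (_ : true) => is_derive_bigsum (sd i)).
apply: is_derive_eq (is_deriveZ 2^-1 Sd) _.
rewrite /GRing.scale /=.
under eq_bigr => i _.
  under eq_bigr => j _ do rewrite mulr_sumr.
  rewrite exchange_big /=; over.
rewrite exchange_big /= [in RHS]exchange_big /= mulr_sumr -sumrN.
apply: eq_bigr => k _.
have := laplacian_form (fun i => q t i 0 k) (u^~ k) esym gsym.
rewrite -sumrN => H.
transitivity (\sum_(i < N) \sum_(j < N | e i j)
    g i j * ((q t j 0 k - q t i 0 k) * (u j k - u i k))).
  rewrite mulr_sumr; apply: eq_bigr => i _; rewrite mulr_sumr.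
  by apply: eq_bigr => j _; rewrite !mxE; field.
by rewrite H; apply: eq_bigr => i _; rewrite /feedback mulNr opprK mulrC.
Qed.

(** * Lower bound on the dissipation *)

(** The graph of [x |-> x * sat lo hi x] lies above a wedge of any slope [b]
    not exceeding the saturation bounds. *)
Lemma sat_mul_ge (R : realType) (lo hi b x : R) :
  lo < 0 < hi -> 0 <= b -> b <= hi -> b <= - lo ->
  b * `|x| - b ^+ 2 <= x * sat lo hi x.
Proof.
move=> /andP[lo0 hi0] b0 bhi blo; rewrite /sat.
case: ltP => xlo; [|case: ltP => xhi].
- by rewrite ltr0_norm; nra.
- by rewrite gtr0_norm; nra.
- have -> : x * x = `|x| ^+ 2 by rewrite real_normK ?num_real.
  by have := normr_ge0 x; nra.
Qed.

Lemma finite_pos_lower_bound (R : realType) (I : finType) (a : I -> R) :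
  (forall i, 0 < a i) -> exists2 b, 0 < b & forall i, b <= a i.
Proof.
move=> a0; exists (\big[Num.min/1]_i a i).
  by apply: lt_bigmin => // i _; exact: a0.
by move=> i; exact: bigmin_le_cond.
Qed.

(** A simple path in a graph on [N] vertices has fewer than [N] edges. *)
Lemma connected_oscillation (R : realType) (N : nat) (e : rel 'I_N)
    (y : 'I_N -> R) (d : R) :
  (forall i j, connect e i j) -> 0 <= d ->
  (forall i j, e i j -> `|y i - y j| <= d) ->
  forall i j, `|y i - y j| <= N%:R * d.
Proof.
move=> econ d0 yd i j.
have [p ep ->] := connectP (econ i j).
case: (shortenP ep) => p' ep' up' _.
have : `|y i - y (last i p')| <= (size p')%:R * d.
  elim: p' i {up' ep p j} ep' => [i _|k p IH i /= /andP[eik ekp]].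
    by rewrite /= subrr normr0 mul0r.
  have := ler_normD (y i - y k) (y k - y (last k p)).
  rewrite addrA subrK => /le_trans; apply.
  by rewrite mulrS mulrDl mul1r lerD ?yd ?IH.
move=> /le_trans; apply; apply: ler_wpM2r => //.
rewrite ler_nat; apply: leq_trans (_ : size (i :: p') <= N)%N; first by [].
by rewrite -(card_uniqP up') -[X in (_ <= X)%N]card_ord max_card.
Qed.

(** While the energy stays above [L] and the edges keep a margin, the
    saturated controls dissipate energy at a rate bounded below.  Summation by
    parts bounds the sum of the [|u_ik|] below; the wedge inequality
    [sat_mul_ge], with slope [b] small enough, transfers this to the saturated
    products. *)
Lemma dissipation_ge (R : realType) (N n : nat) (e : rel 'I_N)
    (F f : R -> R) (lo hi : 'I_N -> 'I_n -> R) (rho c C L : R) :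
  symmetric e -> (forall i j, connect e i j) ->
  (forall i k, lo i k < 0 < hi i k) ->
  0 <= rho -> 0 < c -> 0 < C -> 0 < L ->
  (forall x, 0 <= x <= rho ^+ 2 ->
      [/\ c <= f x, f x <= C, c * x <= F x & F x <= C * x]) ->
  exists2 w, 0 < w & forall x : 'I_N -> 'rV[R]_n,
    (forall i j, e i j -> sqn (x j - x i) <= rho ^+ 2) ->
    L <= energy e F x ->
    w <= \sum_i \sum_k
           feedback e f x i k * sat (lo i k) (hi i k) (feedback e f x i k).
Proof.
move=> esym econ lohi rho0 c0 C0 L0 fF.
(* [D] bounds the coordinate distances between any two agents, and [A] will
   bound the sum of the [|u_ik|] below. *)
pose D := N%:R * rho + 1.
have D0 : 0 < D by rewrite ltr_wpDl // mulr_ge0.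
pose A := 2 * (c * L) / (C * D).
have A0 : 0 < A by rewrite divr_gt0 ?mulr_gt0.
have [b0 b00 b0le] : exists2 b, 0 < b &
    forall ik : 'I_N * 'I_n, b <= Num.min (hi ik.1 ik.2) (- lo ik.1 ik.2).
  apply: finite_pos_lower_bound => -[i k] /=.
  by rewrite lt_min; have /andP[? ?] := lohi i k; lra.
pose M : R := N%:R * n%:R.
have M0 : 0 <= M by rewrite mulr_ge0.
(* this slope makes the loss [b ^+ 2 * M] at most half of the gain [b * A] *)
pose b := Num.min b0 (A / (2 * (M + 1))).
have bpos : 0 < b by rewrite lt_min b00 divr_gt0 //; lra.
have bA : b * M <= A / 2.
  have : b <= A / (2 * (M + 1)) by rewrite ge_min lexx orbT.
  by rewrite ler_pdivlMr; [nra | lra].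
exists (b * (A / 2)); first by rewrite mulr_gt0 // divr_gt0.
move=> x xr xL.
set u := feedback e f x.
pose g i j := f (sqn (x j - x i)).
have gsym i j : g i j = g j i by rewrite /g sqnB.
have coord i j k : `|x i 0 k - x j 0 k| <= N%:R * rho.
  apply: (@connected_oscillation _ _ e (fun i => x i 0 k)) => // {}i {}j eij.
  rewrite -ler_sqr ?nnegrE // real_normK ?num_real //.
  apply: le_trans (xr i j eij); apply: le_trans (sqr_coord_le_sqn _ k).
  by rewrite !mxE -sqrrN opprB.
have [i0 _|none] := pickP (fun _ : 'I_N => true); last first.
  by move: xL; rewrite /energy big_pred0 ?mulr0 //; lra.
have quad : 2 * (c * L) <= C * \sum_i \sum_(j | e i j) g i j * sqn (x j - x i).
  have -> : 2 * (c * L) = c * (2 * L) by ring.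
  have : c * (2 * L) <= c * \sum_i \sum_(j | e i j) F (sqn (x j - x i)).
    rewrite ler_pM2l //; move: xL; rewrite /energy; lra.
  move=> /le_trans; apply; rewrite !mulr_sumr; apply: ler_sum => i _.
  rewrite !mulr_sumr; apply: ler_sum => j eij.
  have s0 := sqn_ge0 (x j - x i); have sr := xr i j eij.
  have [f1 f2 F1 F2] := fF (sqn (x j - x i)) ltac:(lra).
  apply: le_trans (_ : c * (C * sqn (x j - x i)) <= _).
    by rewrite ler_pM2l.
  by rewrite mulrCA ler_pM2l // ler_wpM2r.
(* the feedbacks sum to zero, so positions may be taken relative to agent [i0] *)
have parts : \sum_i \sum_(j | e i j) g i j * sqn (x j - x i) =
    - \sum_i \sum_k u i k * (x i 0 k - x i0 0 k).
  under eq_bigr => i _.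
    under eq_bigr => j _ do rewrite /sqn mulr_sumr.
    rewrite exchange_big /=; over.
  rewrite exchange_big [in RHS]exchange_big -sumrN; apply: eq_bigr => k _ /=.
  have := laplacian_form (fun i => x i 0 k) (fun i => x i 0 k - x i0 0 k)
    esym gsym.
  rewrite -sumrN => H.
  transitivity (\sum_i \sum_(j | e i j) g i j * ((x j 0 k - x i 0 k) *
      (x j 0 k - x i0 0 k - (x i 0 k - x i0 0 k)))).
    by apply: eq_bigr => i _; apply: eq_bigr => j _; rewrite !mxE; ring.
  by rewrite H; apply: eq_bigr => i _; rewrite /u /feedback mulNr opprK mulrC.
have l1 : A <= \sum_i \sum_k `|u i k|.
  rewrite /A ler_pdivrMr ?mulr_gt0 //; apply: le_trans quad _.
  rewrite parts mulrCA ler_pM2l // mulr_suml -sumrN; apply: ler_sum => i _.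
  rewrite mulr_suml -sumrN; apply: ler_sum => k _.
  apply: le_trans (ler_norm _) _; rewrite normrN normrM ler_wpM2l //.
  by apply: le_trans (coord _ _ _) _; rewrite lerDl.
have wedge : b * \sum_i \sum_k `|u i k| - b ^+ 2 * M <=
    \sum_i \sum_k u i k * sat (lo i k) (hi i k) (u i k).
  have -> : b ^+ 2 * M = \sum_(i < N) \sum_(k < n) b ^+ 2.
    rewrite !sumr_const !card_ord -mulrnA -mulr_natr natrM /M; ring.
  rewrite mulr_sumr -sumrB; apply: ler_sum => i _.
  rewrite mulr_sumr -sumrB; apply: ler_sum => k _.
  have := b0le (i, k); rewrite le_min /= => /andP[b1 b2].
  have bb0 : b <= b0 by rewrite ge_min lexx.
  by apply: sat_mul_ge; [exact: lohi | lra..].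
apply: le_trans wedge.
have : b * A <= b * \sum_i \sum_k `|u i k| by rewrite ler_pM2l.
by have : b * (b * M) <= b * (A / 2) by [rewrite ler_pM2l]; lra.
Qed.

(** * A uniform margin below the communication radius *)

Lemma segment_uniform_continuity (R : realType) (g : R -> R) (a b eps : R) :
  {within `[a, b], continuous g} -> 0 < eps ->
  exists2 d, 0 < d & forall s t, a <= s <= b -> a <= t <= b ->
    `|s - t| < d -> `|g s - g t| < eps.
Proof.
move=> /subspace_continuousP gc eps0.
have /compact_near_coveringP/near_covering_withinP cover :=
  @segment_compact R a b.
pose P d s := forall t, a <= t <= b -> `|s - t| < d -> `|g s - g t| < eps.
have /cover : forall x, `[a, b]%classic x ->
    \forall s \near x & d \near (0 : R)^'+, `[a, b]%classic s -> P d s.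
  move=> x xab; have /cvgrPdist_lt/(_ (eps / 2)) := gc x xab.
  rewrite divr_gt0 // near_withinE => /(_ isT)[d /= d0 gd].
  exists (ball x (d / 2), [set z | 0 < z < d / 2]).
    split; first by apply: nbhsx_ballx; rewrite divr_gt0.
    near=> z => /=; apply/andP; split=> //.
    by near: z; apply: nbhs_right_lt; rewrite divr_gt0.
  move=> [s z] /= [xs /andP[z0 zd]] sab t tab st.
  rewrite /ball /= in xs.
  have gs : `|g x - g s| < eps / 2 by apply: gd => //=; lra.
  have gt : `|g x - g t| < eps / 2.
    apply: gd => /=; last by rewrite in_itv.
    have := ler_normD (x - s) (s - t); rewrite addrA subrK; lra.
  have := ler_normD (g s - g x) (g x - g t).
  rewrite addrA subrK distrC; rewrite (distrC (g s)); lra.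
move=> near_d.
near (0 : R)^'+ => d.
exists d => // s t sab tab.
have : `[a, b]%classic `<=` P d by near: d; exact: near_d.
by move=> /(_ s); rewrite /= in_itv /= => /(_ sab t tab).
Unshelve. all: by end_near. Qed.

(** Configurations of energy at most [V0 < Psimax] that have no edge of length
    [r] or more stay uniformly away from having one. *)
Lemma edge_margin (R : realType) (N n : nat) (e : rel 'I_N) (r : R)
    (psi : R -> \bar R) (Psimax : \bar R) (F f : R -> R) (V0 : R) :
  0 < r -> generalized_potential n e r psi Psimax ->
  square_profile r psi F f -> (V0%:E < Psimax)%E ->
  exists2 rho, 0 <= rho < r & forall x : 'I_N -> 'rV[R]_n,
    (forall i j, e i j -> enorm (x j - x i) < r) -> energy e F x <= V0 ->
    forall i j, e i j -> enorm (x j - x i) <= rho.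
Proof.
move=> r0 pot prof V0max.
have [_ psiF _ _ _] := prof.
have psicr : psi @ within `[0, r] (nbhs r) --> psi r.
  have /subspace_continuousP := potential_continuous pot.
  by apply; rewrite /= in_itv /= lexx ltW.
have Fpsi (y : 'rV[R]_n) : F (sqn y) = fine (psi (enorm y)).
  by rewrite -sqr_enorm psiF // enorm_ge0.
have F0 (y : 'rV[R]_n) : enorm y <= r -> 0 <= F (sqn y).
  by move=> yr; rewrite Fpsi fine_ge0 // (potential_ge0 pot) ?enorm_ge0.
have psifin s : 0 <= s < r -> psi s \is a fin_num := potential_fin pot (s := s).
have psir0 : (0 <= psi r)%E by apply: (potential_ge0 pot); lra.
case psirE : (psi r) psir0 psicr => [p| |] // _ psicr; last first.
  (* [psi r] infinite: an edge of length close to [r] costs more than [2 * V0] *)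
  have /cvgeyPgt/(_ (2 * V0)) := psicr; rewrite near_withinE => -[d /= d0 psid].
  exists (r - Num.min d r).
    have : 0 < Num.min d r by rewrite lt_min d0.
    have : Num.min d r <= r by rewrite ge_min lexx orbT.
    lra.
  move=> x xr xV i j eij; rewrite leNgt; apply/negP => dij.
  have ij0 := enorm_ge0 (x j - x i); have ijr := xr i j eij.
  have : ((2 * V0)%:E < psi (enorm (x j - x i)))%E.
    apply: psid => /=; last by rewrite in_itv /=; lra.
    rewrite gtr0_norm; last by lra.
    have : Num.min d r <= d by rewrite ge_min lexx.
    lra.
  rewrite -(fineK (psifin _ _)); last by rewrite ij0.
  rewrite lte_fin -Fpsi ltNge => /negP; apply.
  have : F (sqn (x j - x i)) <= \sum_i \sum_(j | e i j) F (sqn (x j - x i)).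
    have row_ge0 k : 0 <= \sum_(l | e k l) F (sqn (x l - x k)).
      by apply: sumr_ge0 => l ekl; rewrite F0 // ltW // xr.
    rewrite (bigD1 i) //= (bigD1 j) //= -addrA lerDl addr_ge0 //.
      by apply: sumr_ge0 => l /andP[eil _]; rewrite F0 // ltW // xr.
    by apply: sumr_ge0 => k _; exact: row_ge0.
  by move: xV; rewrite /energy; lra.
(* From here on [psi r] is finite. *)
have psifin' s : 0 <= s <= r -> psi s \is a fin_num.
  move=> /andP[s0]; rewrite le_eqVlt => /predU1P[->|sr]; first by rewrite psirE.
  by rewrite psifin // s0.
have psic : {within `[0, r], continuous (fine \o psi)}.
  apply/subspace_continuousP => s sr.
  apply: fine_cvg; rewrite /= fineK; last by apply: psifin'; rewrite /= in_itv in sr.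
  by have /subspace_continuousP := potential_continuous pot; apply.
(* [Psimax] may still be infinite, in which case any [eta] will do *)
have [eta eta0 V0eta] : exists2 eta, 0 < eta & ((V0 + eta)%:E < Psimax)%E.
  case: (Psimax) V0max => [P| |] //.
    rewrite lte_fin => V0P; exists ((P - V0) / 2); first by lra.
    by rewrite lte_fin; lra.
  by exists 1 => //; rewrite ltry.
pose M : R := N%:R * N%:R.
have M0 : 0 <= M by rewrite mulr_ge0.
have [|d d0 psid] := segment_uniform_continuity psic (eps := eta / (M + 1)).
  by rewrite divr_gt0 //; lra.
exists (r - Num.min d r).
  have : 0 < Num.min d r by rewrite lt_min d0.
  have : Num.min d r <= r by rewrite ge_min lexx orbT.
  lra.
move=> x xr xV i j eij; rewrite leNgt; apply/negP => dij.
have [[a b] /= eab abmax] := @arg_maxP _ R _ (i, j) (fun k => e k.1 k.2)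
  (fun k => enorm (x k.2 - x k.1)) eij.
set m := enorm (x b - x a) in abmax.
have mr : m < r := xr a b eab.
have md : r - d < m /\ 0 < m.
  have := abmax (i, j) eij; rewrite /= => ijm.
  have : Num.min d r <= r by rewrite ge_min lexx orbT.
  have : Num.min d r <= d by rewrite ge_min lexx.
  lra.
(* dilating the configuration brings its longest edge to length exactly r *)
pose y k := (r / m) *: x k.
have yE k l : enorm (y l - y k) = r / m * enorm (x l - x k).
  by rewrite /y -scalerBr enormZ // divr_ge0 //; lra.
have stretch s : 0 <= s <= m -> s <= r / m * s <= r /\ r / m * s - s < d.
  move=> sm; have rm : r / m * m = r by rewrite divfK //; lra.
  have rm1 : 1 <= r / m by rewrite ler_pdivlMr; lra.
  by nra.
have yr k l : e k l -> enorm (y l - y k) <= r.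
  move=> ekl; rewrite yE; apply: proj2 (andP (proj1 (stretch _ _))).
  by rewrite enorm_ge0 (abmax (k, l) ekl).
have : (Psimax <= total_potential e psi y)%E.
  apply: (potential_max pot) => //; exists a, b; split=> //.
  by rewrite yE -/m divfK //; lra.
rewrite (total_potential_energy prof); last first.
  by move=> k l ekl; apply: psifin'; rewrite enorm_ge0 yr.
move=> /(lt_le_trans V0eta); rewrite lte_fin ltNge => /negP; apply.
have : \sum_k \sum_(l | e k l) F (sqn (y l - y k)) <=
    \sum_k \sum_(l | e k l) F (sqn (x l - x k)) +
    \sum_(k < N) \sum_(l < N) eta / (M + 1).
  rewrite -big_split /=; apply: ler_sum => k _.
  have -> : \sum_(l < N) eta / (M + 1) = \sum_(l < N | e k l) eta / (M + 1) +
      \sum_(l < N | ~~ e k l) eta / (M + 1) by rewrite (bigID (e k)).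
  rewrite addrA -big_split /=.
  have eps0 : 0 <= eta / (M + 1) by rewrite divr_ge0 //; lra.
  apply: ler_wpDr; first exact: sumr_ge0.
  apply: ler_sum => l ekl; rewrite !Fpsi -lerBlDl.
  have s0 := enorm_ge0 (x l - x k); have s1 := abmax (k, l) ekl.
  have [] := stretch (enorm (x l - x k)); first by rewrite s0.
  move=> /andP[s2 s3] s4; rewrite yE.
  apply: le_trans (ler_norm _) _; apply: ltW; apply: psid.
  - by lra.
  - by rewrite s0 ltW // xr.
  - by rewrite ger0_norm; lra.
rewrite !sumr_const !card_ord -mulrnA -mulr_natr natrM -/M.
have : eta / (M + 1) * M <= eta.
  by rewrite mulrAC ler_pdivrMr; nra.
by move: xV; rewrite /energy; lra.
Qed.

(** * Trajectories of the closed loop *)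

Lemma continuous_sqn (R : realType) (n : nat) : continuous (@sqn R n).
Proof.
apply: continuous_big => [|k _]; first exact: add_continuous.
by move=> x; have xk := @coord_continuous R 1 n 0 k x; exact: (cvgM xk xk).
Qed.

Lemma is_derive_coord (R : realType) (n : nat) (p : R -> 'rV[R]_n) (t : R)
    (v : 'rV[R]_n) (k : 'I_n) :
  is_derive t 1 p v -> is_derive t 1 (fun s => p s 0 k) (v 0 k).
Proof.
move=> [pd pv]; split; first by have /derivable_mxP := pd; apply.
by rewrite -pv derive_mx // mxE.
Qed.

Section trajectory.
Context {R : realType} {N n : nat} (e : rel 'I_N) (r : R).
Context (psi : R -> \bar R) (F f : R -> R).
Context (lo hi : 'I_N -> 'I_n -> R) (q : R -> 'I_N -> 'rV[R]_n).
Context (prof : square_profile r psi F f).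
Context (esym : symmetric e).
Context (r0 : 0 < r).
Context (lohi : forall i k, lo i k < 0 < hi i k).
Context (sol : closed_loop_solution e r psi lo hi q).

Local Notation time := (`[(0 : R), +oo[%classic).
Local Notation short t := (forall i j, e i j -> enorm (q t j - q t i) < r).
Local Notation u t i k := (feedback e f (q t) i k).

Let cvg_sqn_edge (t : R) i j : 0 <= t ->
  sqn (q s j - q s i) @[s --> within time (nbhs t)] --> sqn (q t j - q t i).
Proof.
move=> t0; have qc k : q s k @[s --> within time (nbhs t)] --> q t k.
  have /subspace_continuousP := sol.1 k; apply.
  by rewrite /= in_itv /= t0.
exact: (cvg_comp _ _ (cvgB (qc j) (qc i)) (@continuous_sqn R n _)).
Qed.

Let cvg_energy (t : R) : 0 <= t -> short t ->
  energy e F (q s) @[s --> within time (nbhs t)] --> energy e F (q t).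
Proof.
move=> t0 st; have [_ _ _ Fd _] := prof.
apply: cvgM; first exact: cvg_cst.
apply: cvg_big => [|i _]; first exact: add_continuous.
apply: cvg_big => [|j eij]; first exact: add_continuous.
set x := sqn (q t j - q t i).
have [Fx _] : is_derive x 1 F (f x).
  by apply: Fd; rewrite sqn_ge0 sqn_lt_sqr ?st // ltW.
have Fc : {for x, continuous F}.
  exact/differentiable_continuous/derivable1_diffP.
exact: (cvg_comp _ F (cvg_sqn_edge t0) Fc).
Qed.

(** Along the part of a trajectory on which the edges are shorter than the
    communication radius, the energy decreases at the rate at which the
    saturated controls dissipate it. *)
Lemma energy_decrease (s t w : R) : 0 <= s <= t ->
  (forall x, s <= x <= t -> short x) ->
  (forall x, s <= x <= t ->
     w <= \sum_i \sum_k u x i k * sat (lo i k) (hi i k) (u x i k)) ->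
  energy e F (q t) <= energy e F (q s) - w * (t - s).
Proof.
move=> /andP[s0 st] shortx wx.
have [x| |x] := @MVT_segment R (fun x => energy e F (q x))
  (fun x => - \sum_i \sum_k u x i k * sat (lo i k) (hi i k) (u x i k)) s t st.
- rewrite in_itv /= => sxt; have shx := shortx x ltac:(lra).
  have sqx i j : e i j -> sqn (q x j - q x i) < r ^+ 2.
    by move=> eij; rewrite sqn_lt_sqr ?shx // ltW.
  apply: (is_derive_energy esym prof) => // i k.
  have qd : is_derive x 1 (fun s => q s i)
      (Sat (lo i) (hi i) (nominal_control e psi (q x) i)).
    by apply: sol.2 => //; lra.
  apply: is_derive_eq (is_derive_coord k qd) _.
  by rewrite mxE (nominal_control_feedback _ _ prof).
- apply/subspace_continuousP => x xst.
  have x0 : s <= x <= t by move: xst; rewrite /= in_itv.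
  apply: cvg_trans (cvg_energy _ (shortx x x0)); last by lra.
  apply: cvg_app; apply: within_subset => y /=; rewrite !in_itv /=; lra.
rewrite in_itv /= => xst; rewrite mulNr => E.
have : w * (t - s) <=
    (\sum_i \sum_k u x i k * sat (lo i k) (hi i k) (u x i k)) * (t - s).
  by apply: ler_wpM2r; [lra | exact: wx].
by lra.
Qed.

Lemma energy_nonincreasing (s t : R) : 0 <= s <= t ->
  (forall x, s <= x <= t -> short x) ->
  energy e F (q t) <= energy e F (q s).
Proof.
move=> st shortx; have := energy_decrease (w := 0) st shortx.
rewrite mul0r subr0; apply => x _.
apply: sumr_ge0 => i _; apply: sumr_ge0 => k _.
have := sat_mul_ge (b := 0) (u x i k) (lohi i k) (lexx _).
rewrite mul0r expr0n subr0; have /andP[? ?] := lohi i k; apply; lra.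
Qed.

(** A barrier: if low energy keeps the edges at length at most [rho < r], then
    a trajectory of low initial energy never reaches length [r]. *)
Lemma edges_stay_short (rho : R) : 0 <= rho < r -> short 0 ->
  (forall x : 'I_N -> 'rV[R]_n, (forall i j, e i j -> enorm (x j - x i) < r) ->
     energy e F x <= energy e F (q 0) ->
     forall i j, e i j -> enorm (x j - x i) <= rho) ->
  forall t, 0 <= t -> short t.
Proof.
move=> /andP[rho0 rhor] short0 margin t1 t10; apply: contrapT => t1long.
pose B := [set t : R | 0 <= t /\ ~ short t].
have Bt1 : B t1 by [].
have Blb : lbound B 0 by move=> t [].
have hB : has_inf B by split; [exists t1 | exists 0].
pose T := inf B.
have T0 : 0 <= T by apply: lb_le_inf; [exists t1|].
(* [T] is the first exit time: nothing has happened before it *)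
have before s : 0 <= s < T -> short s.
  move=> /andP[s0 sT]; apply: contrapT => slong.
  have : T <= s by apply: ge_inf; [exists 0 | split].
  by lra.
have margin_before s : 0 <= s -> (forall x, 0 <= x <= s -> short x) ->
    forall i j, e i j -> enorm (q s j - q s i) <= rho.
  move=> s0 shx; apply: margin; first by apply: shx; rewrite s0 lexx.
  by apply: energy_nonincreasing => //; rewrite lexx.
have atT i j : e i j -> sqn (q T j - q T i) <= rho ^+ 2.
  move=> eij; have [T_0|Tpos] : T = 0 \/ 0 < T.
    by move: T0; rewrite le_eqVlt => /predU1P[->|]; [left | right].
    rewrite T_0 sqn_le_sqr //; apply: margin_before => // x x0.
    by have -> : x = 0 by lra.
  rewrite leNgt; apply/negP => far.
  have /cvgrPdist_lt/(_ (sqn (q T j - q T i) - rho ^+ 2)) :=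
    @cvg_sqn_edge T i j T0.
  rewrite subr_gt0 => /(_ far); rewrite near_withinE => -[d /= d0 near_T].
  pose m := Num.min d T.
  have m0 : 0 < m by rewrite lt_min d0.
  have [md mT] : m <= d /\ m <= T by rewrite !ge_min !lexx orbT.
  have := near_T (T - m / 2); rewrite /= in_itv /= opprB addrC subrK andbT.
  rewrite gtr0_norm ?divr_gt0 // => /(_ ltac:(lra) ltac:(lra)).
  have : sqn (q (T - m / 2) j - q (T - m / 2) i) <= rho ^+ 2.
    rewrite sqn_le_sqr //; apply: margin_before => // [|x xT]; first by lra.
    by apply: before; lra.
  by move=> ? /ltr_normlP[]; lra.
(* the margin at [T] extends the good behaviour beyond [T] *)
have : \forall s \near within time (nbhs T), short s.
  apply: filter_forall => i; apply: filter_forall => j.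
  have /cvgrPdist_lt/(_ (r ^+ 2 - rho ^+ 2)) := @cvg_sqn_edge T i j T0.
  rewrite subr_gt0 => /(_ ltac:(nra)); apply: filterS => s sT eij.
  rewrite -sqn_lt_sqr; last by exact: ltW.
  by have := atT i j eij; move/ltr_normlP: sT => []; lra.
rewrite near_withinE => -[d /= d0 near_T].
have [b [b0 blong] bT] := inf_adherent d0 hB.
have Tb : T <= b by apply: ge_inf; [exists 0|].
apply: blong; apply: near_T => /=; last by rewrite in_itv /= b0.
by rewrite distrC ger0_norm; lra.
Qed.

End trajectory.

(** * Connectivity-preserving consensus *)

Theorem mainTheorem2 (R : realType) (N n : nat) (r : R) (e : rel 'I_N)
  (psi : R -> \bar R) (Psimax : \bar R)
  (lo hi : 'I_N -> 'I_n -> R) (q : R -> 'I_N -> 'rV[R]_n)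
  (r_gt0 : 0 < r)
  (e_undirected : symmetric e)
  (e_connected : forall i j, connect e i j)
  (psi_potential : generalized_potential n e r psi Psimax)
  (sat_bounds : forall i k, lo i k < 0 < hi i k)
  (q_solution : closed_loop_solution e r psi lo hi q)
  (q0_edges : exists eps : R, 0 < eps /\
     forall i j, e i j -> enorm (q 0 j - q 0 i) <= r - eps)
  (q0_potential : (total_potential e psi (q 0%R) < Psimax)%E) :
  (forall t : R, 0 <= t -> forall i j, e i j -> enorm (q t i - q t j) < r) /\
  (forall i j, q t i - q t j @[t --> +oo] --> (0 : 'rV[R]_n)).
Proof.
have [F [f prof]] := square_profile_exists r_gt0 psi_potential.
have short0 i j : e i j -> enorm (q 0 j - q 0 i) < r.
  have [eps [eps0 q0]] := q0_edges; move=> /q0; lra.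
have V0max : ((energy e F (q 0))%:E < Psimax)%E.
  rewrite -(total_potential_energy prof) // => i j eij.
  by apply: (potential_fin psi_potential); rewrite enorm_ge0 short0.
have [rho rhor margin] := edge_margin r_gt0 psi_potential prof V0max.
have short : forall t, 0 <= t -> forall i j, e i j -> enorm (q t j - q t i) < r.
  exact: (edges_stay_short prof e_undirected r_gt0 sat_bounds q_solution
    rhor short0 margin).
split=> [t t0 i j eij|]; first by rewrite enormB short.
have nonincr s t : 0 <= s <= t -> energy e F (q t) <= energy e F (q s).
  move=> st.
  apply: (energy_nonincreasing prof e_undirected r_gt0 sat_bounds q_solution st).
  by move=> x sx; apply: short; lra.
have close t : 0 <= t ->
    forall i j, e i j -> sqn (q t j - q t i) <= rho ^+ 2.
  move=> t0 i j eij; have /andP[rho0 _] := rhor.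
  by rewrite sqn_le_sqr // margin //; [exact: short | apply: nonincr; lra].
have [c [C [c0 C0 fF]]] := square_profile_bounds prof rhor.
have sum_sqn_le t : 0 <= t ->
    c * (\sum_i \sum_(j | e i j) sqn (q t j - q t i)) <= 2 * energy e F (q t).
  move=> t0; rewrite /energy mulrA divff ?mul1r ?pnatr_eq0 //.
  rewrite mulr_sumr; apply: ler_sum => i _.
  rewrite mulr_sumr; apply: ler_sum => j eij.
  by have [] := fF (sqn (q t j - q t i)); rewrite ?sqn_ge0 ?close.
have sqn_le t i j : 0 <= t -> e i j ->
    c * sqn (q t j - q t i) <= 2 * energy e F (q t).
  move=> t0 eij; apply: le_trans (sum_sqn_le t t0); rewrite ler_pM2l //.
  have nonneg k (P : pred 'I_N) : 0 <= \sum_(l | P l) sqn (q t l - q t k).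
    by apply: sumr_ge0 => l _; exact: sqn_ge0.
  rewrite (bigD1 i) //= (bigD1 j) //= -addrA lerDl addr_ge0 ?nonneg //.
  by apply: sumr_ge0 => k _.
have energy_ge0 t : 0 <= t -> 0 <= energy e F (q t).
  move=> t0; have := sum_sqn_le t t0.
  have : 0 <= c * (\sum_i \sum_(j | e i j) sqn (q t j - q t i)).
    apply: mulr_ge0; first exact: ltW.
    by apply: sumr_ge0 => k _; apply: sumr_ge0 => l _; exact: sqn_ge0.
  lra.
have energy_small L : 0 < L -> exists2 T, 0 <= T & energy e F (q T) < L.
  move=> L0; apply: contrapT => never.
  have large t : 0 <= t -> L <= energy e F (q t).
    by move=> t0; rewrite leNgt; apply/negP => tL; apply: never; exists t.
  have /andP[rho0 _] := rhor.
  have [w w0 diss] :=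
    dissipation_ge e_undirected e_connected sat_bounds rho0 c0 C0 L0 fF.
  have V0 := energy_ge0 0 (lexx 0).
  (* at this time the energy would have been used up completely *)
  pose T := energy e F (q 0) / w.
  have T0 : 0 <= T by rewrite divr_ge0 // ltW.
  have : energy e F (q T) <= energy e F (q 0) - w * (T - 0).
    apply: (energy_decrease prof e_undirected r_gt0 q_solution).
    - by rewrite lexx.
    - by move=> x xT; apply: short; lra.
    - move=> x xT; have x0 : 0 <= x by lra.
      by apply: diss; [exact: close | exact: large].
  rewrite subr0 mulrC divfK ?gt_eqF //; have := large T T0; lra.
move=> i j; apply/cvgrPdist_lt => eps eps0.
pose d := eps / (N%:R + 1).
have N0 : 0 <= N%:R :> R by [].
have d0 : 0 < d by rewrite divr_gt0 //; lra.
have Nd : N%:R * d < eps.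
  by rewrite /d mulrCA gtr_pMr // ltr_pdivrMr; lra.
have [T T0 VT] : exists2 T, 0 <= T & energy e F (q T) < c * d ^+ 2 / 2.
  by apply: energy_small; rewrite divr_gt0 ?mulr_gt0 ?exprn_gt0.
near=> t.
have Tt : T <= t by near: t; apply: nbhs_pinfty_ge; exact: num_real.
have t0 : 0 <= t by lra.
have coord k : `|q t i 0 k - q t j 0 k| < eps.
  apply: le_lt_trans Nd.
  apply: (connected_oscillation (y := fun i => q t i 0 k) e_connected (ltW d0)).
  move=> a b eab; rewrite -ler_sqr ?nnegrE ?(ltW d0) // real_normK ?num_real //.
  rewrite -(ler_pM2l c0).
  have : c * (q t a 0 k - q t b 0 k) ^+ 2 <= c * sqn (q t b - q t a).
    rewrite ler_pM2l // -[X in X ^+ 2]opprB sqrrN.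
    by have := sqr_coord_le_sqn (q t b - q t a) k; rewrite !mxE.
  have := sqn_le t a b t0 eab; have := nonincr T t; rewrite T0 Tt => /(_ isT).
  lra.
rewrite sub0r normrN /Num.norm /= mx_normrE.
apply: bigmax_lt => //= -[a k] _ /=.
by rewrite ord1 !mxE.
Unshelve. all: by end_near. Qed.
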